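(* Let $I\subset\mathbb{R}$ be an interval and $V,\tilde V:I\to\mathbb{C}$ sufficiently smooth. Let $\tilde y=\alpha+i\tilde\beta$ (with $\alpha,\tilde\beta$ real-valued) be a solution on $I$ of $\tilde y'=\tilde V-\tilde y^2$, and set $U=\operatorname{Re}V-\alpha^2-\alpha'$ and $\sigma(u)=\exp\big(\int^u2\alpha\big)$. For an increasing function $g:I\to\mathbb{R}$ set $$\kappa(u)=\frac{g(u)}{\sigma(u)}+\frac{1}{\sigma(u)}\int^u\sigma\,\operatorname{Im}(V-\tilde V),$$ and choose real functions $R$ and $\beta$ by $$R+\beta=\tilde\beta+\kappa,\qquad R-\beta=\frac{U}{R+\beta},$$ where it is assumed that $R+\beta$ has no zeros, $R\ge0$ and $(R+\beta)\,\mathfrak{D}\ge 0$ on $I$. Assume moreover that the determinator $$\mathfrak{D}=2\alpha U+\frac{U'}{2}+\beta\operatorname{Im}V$$ is positive on $I$. Let $y$ be a solution of the Riccati equation $y'=V-y^2$ on $I$ lying in the upper half plane, $\operatorname{Im}y>0$. Then the circle centered at $m=\alpha+i\beta$ with radius $R$ is invariant on $I$ under the Riccati flow, i.e. for all $u_0,u_1\in I$ with $u_1>u_0$, $$|y(u_0)-m(u_0)|\le R(u_0)\ \Longrightarrow\ |y(u_1)-m(u_1)|\le R(u_1).$$ Moreover, $$\kappa-R=\frac{\kappa^2-\operatorname{Re}(V-\tilde V)}{2(\tilde\beta+\kappa)}.$$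
   Context: All integrals $\int^u$ are taken from a fixed base point in $I$. In applications $\tilde y=\tilde\phi'/\tilde\phi$ with $\tilde\phi$ a solution of $-\tilde\phi''+\tilde V\tilde\phi=0$. *)

(* Defs.v *)
From Stdlib Require Export Reals.
From Coquelicot Require Export Coquelicot.
Open Scope R_scope.

Definition is_interval (I : R -> Prop) : Prop :=
  is_connected I /\ exists a b : R, I a /\ I b /\ a < b.

(* [is_derive] with the neighbourhood filter restricted to [I], so that the
   derivative is one-sided at an end point of [I] and values outside [I] are
   irrelevant. *)
Definition is_derive_on {E : NormedModule R_AbsRing}
    (I : R -> Prop) (f : R -> E) (x : R) (l : E) : Prop :=
  filterdiff f (within I (locally x)) (fun h : R => scal h l).

(* Total operator, built as [RInt] is; only meaningful where the derivative
   exists. *)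
Definition Derive_on (I : R -> Prop) (f : R -> R) (x : R) : R :=
  iota (is_derive_on I f x).

Definition C1_on {E : NormedModule R_AbsRing} (I : R -> Prop) (f : R -> E)
    : Prop :=
  exists f' : R -> E,
    (forall x : R, I x -> is_derive_on I f x (f' x)) /\ continuous_on I f'.

(* C is differentiated along the real line, hence its real normed module
   structure. *)
Definition riccati_solution (I : R -> Prop) (V y : R -> C) : Prop :=
  forall u : R, I u ->
    is_derive_on (E := C_R_NormedModule) I y u (V u - y u * y u)%C.

Definition Ufun (I : R -> Prop) (V : R -> C) (alpha : R -> R) (u : R) : R :=
  Re (V u) - alpha u ^ 2 - Derive_on I alpha u.

Definition sigma (base : R) (alpha : R -> R) (u : R) : R :=
  exp (RInt (fun t => 2 * alpha t) base u).

Definition kappa (base : R) (V Vt : R -> C) (alpha g : R -> R) (u : R) : R :=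
  g u / sigma base alpha u
  + 1 / sigma base alpha u
    * RInt (fun t => sigma base alpha t * Im (V t - Vt t)%C) base u.

Definition determinator (I : R -> Prop) (V : R -> C) (alpha beta : R -> R)
    (u : R) : R :=
  2 * alpha u * Ufun I V alpha u
  + Derive_on I (Ufun I V alpha) u / 2
  + beta u * Im (V u).

(* Main.v *)
Require Import Defs.
From Stdlib Require Import Reals Lra Psatz Classical.
From Coquelicot Require Import Coquelicot.
Open Scope R_scope.

(** Write y = alpha + a + i b and let S = R + beta be the height of the top of
    the circle.  Since R^2 - beta^2 = U, the circle is determined by U and S:
    R = (S + U/S)/2, beta = (S - U/S)/2, and y lies in the disc exactly when
    the power of y with respect to the circle,

      F = |y - m|^2 - R^2 = a^2 + b^2 - U - b (S - U/S)
        = a^2 + (b - S)^2 + 2 R (b - S),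

    is nonpositive.  The hypotheses on R + beta and on the determinator D give
    S > 0.

    Only S feels the function g, and it does so through
    sigma S = g + (primitive of sigma Im V) + const.
    Where g stays constant, S' = Im V - 2 alpha S, and a computation gives
    R' = D/S - 2 alpha R and

      (F/R)' = - 2 (alpha + a) F/R - D/(S R^2) (a^2 + (b - S)^2).

    So F/R, multiplied by an integrating factor, is nonincreasing as long as
    D > 0, S > 0 and R > 0, and F stays nonpositive (lemmas [quotient_derive]
    and [frozen_step]).  If R vanishes at the initial point then R' > 0 and
    F = F' = 0 there, so that F/R still tends to 0.

    In general g is only monotone and may jump.  But F is nonincreasing in S,
    since dF/dS = - 2 b R / S and b > 0: raising g can only enlarge the part of
    the disc in the upper half plane ([power_mono]).  Invariance then follows
    by induction along the real line ([disc_propagates]).  To step to the right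
    of a point p, freeze g at its value at p; by continuity D stays positive
    near p for the frozen circle, hence y stays in the frozen disc, hence in
    the true one.  To reach a point from the left, pass to the left limit of S,
    which is positive because it is at least b, and then raise S to its actual
    value.

    The last identity of the theorem is algebra, once the Riccati equation of
    alpha + i betat is used to write U = Re (V - Vt) - betat^2. *)

(** * Circles with a prescribed top *)

(** [circle_radius U s] and [circle_height U s] solve R + beta = s and
    R^2 - beta^2 = U. *)
Definition circle_radius (U s : R) : R := (s + U / s) / 2.
Definition circle_height (U s : R) : R := (s - U / s) / 2.

(** The power |y - m|^2 - R^2 of the point y = alpha + a + i b with respect to
    the circle centered at m = alpha + i beta; it depends on U and on the top s
    of the circle only, because R^2 - beta^2 = U. *)
Definition circle_power (a b U s : R) : R := a ^ 2 + b ^ 2 - U - 2 * b * circle_height U s.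

(** The determinator as a function of the top s of the circle, so that it can
    be evaluated on comparison circles too. *)
Definition determinator_at (alpha v U dU s : R) : R :=
  2 * alpha * U + dU / 2 + circle_height U s * v.

Lemma power_factor a b U s : s <> 0 ->
  circle_power a b U s = a ^ 2 + (b - s) ^ 2 + 2 * circle_radius U s * (b - s).
Proof. intros Hs; unfold circle_power, circle_height, circle_radius; field; exact Hs. Qed.

Lemma radius_nonneg_iff U s : 0 < s -> (0 <= circle_radius U s <-> 0 <= s ^ 2 + U).
Proof.
intros Hs. unfold circle_radius.
assert (E : s ^ 2 + U = 2 * s * ((s + U / s) / 2)) by (field; lra).
rewrite E. split; intros H; nra.
Qed.

Lemma top_of_member a b U s : 0 < s -> 0 <= circle_radius U s ->
  circle_power a b U s <= 0 -> b <= s.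
Proof.
intros Hs HR H. rewrite power_factor in H by lra.
destruct (Rle_or_lt b s) as [|Hb]; [assumption|].
assert (0 < (b - s) ^ 2) by nra. assert (0 <= a ^ 2) by nra. nra.
Qed.

(** The derivative of the power in s is - b (1 + U / s^2), which has the sign of
    - b R; and once R is nonnegative it stays so for larger s.  The difference
    quotient makes the same point without calculus. *)
Lemma power_mono a b U s t : 0 < b -> 0 < s -> s <= t -> 0 <= circle_radius U s ->
  circle_power a b U s <= 0 -> circle_power a b U t <= 0.
Proof.
intros Hb Hs Hst HR HF.
apply radius_nonneg_iff in HR; [|assumption].
assert (E : circle_power a b U t = circle_power a b U s
  - b * ((t - s) * (s * t + U)) / (s * t)).
{ unfold circle_power, circle_height; field; split; lra. }
rewrite E.
assert (0 <= b * ((t - s) * (s * t + U)) / (s * t)).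
{ apply Rmult_le_pos; [|left; apply Rinv_0_lt_compat; nra].
  apply Rmult_le_pos; [lra|]. apply Rmult_le_pos; nra. }
lra.
Qed.

(** * The Riccati flow with a smoothly moving circle *)

(** The real data of the flow on a segment: y = alpha + a + i b, v = Im V and
    U.  The function P is a primitive of sigma v, which carries the smooth part
    of the motion of the circle, and E is an integrating factor for F/R. *)
Record riccati_frame (lo hi : R) (alpha v a b U dU sigma P E : R -> R) : Prop := {
  frame_alpha : forall x, lo <= x <= hi -> continuous alpha x;
  frame_v : forall x, lo <= x <= hi -> continuous v x;
  frame_dU : forall x, lo <= x <= hi -> continuous dU x;
  frame_U : forall x, lo <= x <= hi -> is_derive U x (dU x);
  frame_a : forall x, lo <= x <= hi ->
    is_derive a x (U x - 2 * alpha x * a x - a x ^ 2 + b x ^ 2);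
  frame_b : forall x, lo <= x <= hi ->
    is_derive b x (v x - 2 * (alpha x + a x) * b x);
  frame_sigma : forall x, lo <= x <= hi -> is_derive sigma x (2 * alpha x * sigma x);
  frame_P : forall x, lo <= x <= hi -> is_derive P x (sigma x * v x);
  frame_E : forall x, lo <= x <= hi -> is_derive E x (2 * (alpha x + a x) * E x);
  frame_sigma_pos : forall x, 0 < sigma x;
  frame_E_pos : forall x, 0 < E x;
  frame_b_pos : forall x, lo <= x <= hi -> 0 < b x
}.

Arguments frame_alpha {lo hi alpha v a b U dU sigma P E}.
Arguments frame_v {lo hi alpha v a b U dU sigma P E}.
Arguments frame_dU {lo hi alpha v a b U dU sigma P E}.
Arguments frame_U {lo hi alpha v a b U dU sigma P E}.
Arguments frame_a {lo hi alpha v a b U dU sigma P E}.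
Arguments frame_b {lo hi alpha v a b U dU sigma P E}.
Arguments frame_sigma {lo hi alpha v a b U dU sigma P E}.
Arguments frame_P {lo hi alpha v a b U dU sigma P E}.
Arguments frame_E {lo hi alpha v a b U dU sigma P E}.
Arguments frame_sigma_pos {lo hi alpha v a b U dU sigma P E}.
Arguments frame_E_pos {lo hi alpha v a b U dU sigma P E}.
Arguments frame_b_pos {lo hi alpha v a b U dU sigma P E}.

Lemma is_derive_continuous (f : R -> R) x l : is_derive f x l -> continuous f x.
Proof. intros Hf. apply (ex_derive_continuous f). exists l. exact Hf. Qed.

(** Covers at once an initial point with R > 0 and one with R = 0, where the
    sign has to be read off the derivative. *)
Lemma negative_on_right f p l : is_derive f p l ->
  f p < 0 \/ (f p <= 0 /\ l < 0) -> at_right p (fun x => f x < 0).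
Proof.
intros Hf [H|[H Hl]].
- assert (Hc : continuous f p) by (eapply is_derive_continuous; exact Hf).
  apply filter_le_within. apply (Hc (fun z => z < 0)).
  apply open_lt. exact H.
- apply is_derive_Reals in Hf.
  destruct (Hf (- l / 2)) as [d Hd]; [lra|].
  exists d. change (forall x : R, Rabs (x - p) < d -> p < x -> f x < 0).
  intros x Hx' Hpx.
  specialize (Hd (x - p) ltac:(lra) Hx').
  replace (p + (x - p)) with x in Hd by ring.
  apply Rabs_def2 in Hd. destruct Hd as [Hd _].
  assert (Hq : (f x - f p) / (x - p) < 0) by lra.
  assert (Eq : f x - f p = (f x - f p) / (x - p) * (x - p)) by (field; lra).
  nra.
Qed.

(** The law of motion of the top of the circle while g is constant. *)
Definition frozen_top (alpha v s : R -> R) (x : R) : Prop :=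
  is_derive s x (v x - 2 * alpha x * s x).

Lemma radius_derive {lo hi} {alpha v a b U dU sigma P E s : R -> R} x :
  riccati_frame lo hi alpha v a b U dU sigma P E ->
  lo <= x <= hi -> s x <> 0 -> frozen_top alpha v s x ->
  is_derive (fun t => circle_radius (U t) (s t)) x
    (determinator_at (alpha x) (v x) (U x) (dU x) (s x) / s x
     - 2 * alpha x * circle_radius (U x) (s x)).
Proof.
intros fr Hx Hs Hm. unfold frozen_top in Hm. pose proof (frame_U fr x Hx) as HU.
unfold circle_radius. auto_derive.
- repeat split; try (eexists; eassumption); assumption.
- rewrite (is_derive_unique (fun t : R => U t) _ _ HU),
    (is_derive_unique (fun t : R => s t) _ _ Hm).
  unfold determinator_at, circle_height. field. assumption.
Qed.

Lemma power_derive {lo hi} {alpha v a b U dU sigma P E s : R -> R} x :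
  riccati_frame lo hi alpha v a b U dU sigma P E ->
  lo <= x <= hi -> s x <> 0 -> frozen_top alpha v s x ->
  is_derive (fun t => circle_power (a t) (b t) (U t) (s t)) x
    (- (2 * a x + 4 * alpha x) * circle_power (a x) (b x) (U x) (s x)
     + 2 * (b x / s x - 1) * determinator_at (alpha x) (v x) (U x) (dU x) (s x)).
Proof.
intros fr Hx Hs Hm. unfold frozen_top in Hm. pose proof (frame_U fr x Hx) as HU.
pose proof (frame_a fr x Hx) as Ha.
pose proof (frame_b fr x Hx) as Hb.
unfold circle_power, circle_height. auto_derive.
- repeat split; try (eexists; eassumption); assumption.
- rewrite (is_derive_unique (fun t : R => U t) _ _ HU),
    (is_derive_unique (fun t : R => s t) _ _ Hm),
    (is_derive_unique (fun t : R => a t) _ _ Ha), (is_derive_unique (fun t : R => b t) _ _ Hb).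
  unfold determinator_at, circle_height. field. assumption.
Qed.

(** The heart of the matter.  By [power_factor], F - 2 R (b - S) is the sum of
    squares a^2 + (b - S)^2, and in the derivative of F/R the determinator is
    multiplied by - 1 / (S R^2) times exactly this sum; the other terms are absorbed by E. *)
Lemma quotient_derive {lo hi} {alpha v a b U dU sigma P E s : R -> R} x :
  riccati_frame lo hi alpha v a b U dU sigma P E ->
  lo <= x <= hi -> s x <> 0 -> frozen_top alpha v s x ->
  circle_radius (U x) (s x) <> 0 ->
  is_derive (fun t => circle_power (a t) (b t) (U t) (s t) / circle_radius (U t) (s t) * E t) x
    (- (determinator_at (alpha x) (v x) (U x) (dU x) (s x) * E x
        / (s x * circle_radius (U x) (s x) ^ 2)) * (a x ^ 2 + (b x - s x) ^ 2)).
Proof.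
intros fr Hx Hs Hm HR.
pose proof (power_derive x fr Hx Hs Hm) as HF. pose proof (radius_derive x fr Hx Hs Hm) as HR'.
pose proof (frame_E fr x Hx) as HE.
evar_last.
- apply (is_derive_mult (fun t => circle_power (a t) (b t) (U t) (s t)
    / circle_radius (U t) (s t)) E);
    [|exact HE|intros; apply Rmult_comm].
  apply (is_derive_div (fun t => circle_power (a t) (b t) (U t) (s t))
    (fun t => circle_radius (U t) (s t))); [exact HF|exact HR'|exact HR].
- rewrite (power_factor _ _ _ _ Hs).
  generalize (determinator_at (alpha x) (v x) (U x) (dU x) (s x)); intros D.
  unfold plus, mult; simpl. field. split; assumption.
Qed.

(** As F E / R is nonincreasing, it suffices that its upper limit at lo is at
    most 0, which is expressed by F < eps R for every eps > 0.  When R = 0 at lo,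
    F <= 0 forces a = 0 and b = s there, so F - eps R vanishes at lo with
    derivative - eps D / s. *)
Lemma frozen_step {lo hi} {alpha v a b U dU sigma P E} (s : R -> R) :
  riccati_frame lo hi alpha v a b U dU sigma P E -> lo < hi ->
  (forall x, lo <= x <= hi -> frozen_top alpha v s x) ->
  0 < s lo -> 0 <= circle_radius (U lo) (s lo) ->
  0 < determinator_at (alpha lo) (v lo) (U lo) (dU lo) (s lo) ->
  circle_power (a lo) (b lo) (U lo) (s lo) <= 0 ->
  at_right lo (fun x => 0 < s x /\ 0 <= circle_radius (U x) (s x) /\
    circle_power (a x) (b x) (U x) (s x) <= 0).
Proof.
intros fr Hlh Hm Hs HR HD HF.
assert (Hlo : lo <= lo <= hi) by lra.
assert (Cs : continuous s lo) by (eapply is_derive_continuous; apply Hm; exact Hlo).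
assert (CU : continuous U lo) by (eapply is_derive_continuous; apply (frame_U fr); exact Hlo).
assert (CE : continuous E lo) by (eapply is_derive_continuous; apply (frame_E fr); exact Hlo).
assert (Cdet : continuous (fun x => determinator_at (alpha x) (v x) (U x) (dU x) (s x)) lo).
{ unfold determinator_at, circle_height.
  pose proof (frame_alpha fr _ Hlo) as Ca.
  pose proof (frame_v fr _ Hlo) as Cv.
  pose proof (frame_dU fr _ Hlo) as Cd.
  apply (continuous_plus (fun x => 2 * alpha x * U x + dU x / 2)).
  - apply (continuous_plus (fun x => 2 * alpha x * U x)).
    + apply (continuous_mult (fun x => 2 * alpha x)); [|exact CU].
      apply (continuous_mult (fun x => 2)); [apply continuous_const|exact Ca].
    + apply (continuous_mult dU (fun x => / 2)); [exact Cd|apply continuous_const].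
  - apply (continuous_mult (fun x => (s x - U x / s x) / 2)); [|exact Cv].
    apply (continuous_mult (fun x => s x - U x / s x) (fun x => / 2));
      [|apply continuous_const].
    apply (continuous_minus s); [exact Cs|].
    apply (continuous_mult U (fun x => / s x)); [exact CU|].
    apply (continuous_comp s Rinv); [exact Cs|]. apply continuous_Rinv. lra. }
assert (ev_s : at_right lo (fun x => 0 < s x)).
{ apply filter_le_within. apply (Cs (fun z => 0 < z)). apply open_gt. exact Hs. }
assert (ev_D : at_right lo (fun x => 0 < determinator_at (alpha x) (v x) (U x) (dU x) (s x))).
{ apply filter_le_within. apply (Cdet (fun z => 0 < z)). apply open_gt. exact HD. }
assert (dR := radius_derive lo fr Hlo (Rgt_not_eq _ _ Hs) (Hm _ Hlo)).
assert (dF := power_derive lo fr Hlo (Rgt_not_eq _ _ Hs) (Hm _ Hlo)).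
assert (HDs : 0 < determinator_at (alpha lo) (v lo) (U lo) (dU lo) (s lo) / s lo)
  by (apply Rdiv_lt_0_compat; assumption).
set (D := determinator_at (alpha lo) (v lo) (U lo) (dU lo) (s lo)) in *.
assert (ev_R : at_right lo (fun x => 0 < circle_radius (U x) (s x))).
{ apply (filter_imp (fun x => - circle_radius (U x) (s x) < 0)); [intros; lra|].
  eapply negative_on_right;
    [apply (is_derive_opp (fun x => circle_radius (U x) (s x))); exact dR|].
  unfold opp; simpl.
  destruct HR as [HR|HR]; [left; lra|right]. rewrite <- HR. lra. }
assert (ev_F : forall eps, 0 < eps -> at_right lo (fun x =>
   circle_power (a x) (b x) (U x) (s x) - eps * circle_radius (U x) (s x) < 0)).
{ intros eps Heps.
  eapply negative_on_right.
  - apply (is_derive_minus (fun x => circle_power (a x) (b x) (U x) (s x))); [exact dF|].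
    apply (is_derive_scal (fun x => circle_radius (U x) (s x))); exact dR.
  - unfold minus, plus, opp, scal; simpl. unfold mult; simpl.
    destruct HR as [HR|HR]; [left; nra|right].
    pose proof HF as HF'. rewrite power_factor in HF' by lra. rewrite <- HR in HF' |- *.
    (* With R = 0 the disc is a single point. *)
    assert (Hb : b lo = s lo) by nra. assert (Ha : a lo = 0) by nra.
    assert (HF0 : circle_power (a lo) (b lo) (U lo) (s lo) = 0).
    { rewrite power_factor by lra. rewrite <- HR, Hb, Ha. ring. }
    rewrite HF0, Hb. split; [lra|].
    replace (s lo / s lo) with 1 by (field; lra). nra. }
assert (ev_E : at_right lo (fun x => E x < E lo + 1)).
{ apply filter_le_within. apply (CE (fun z => z < E lo + 1)). apply open_lt. lra. }
assert (ev_hi : at_right lo (fun x => x < hi)).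
{ apply filter_le_within. apply open_lt. exact Hlh. }
destruct (filter_and _ _ ev_s (filter_and _ _ ev_D (filter_and _ _ ev_R ev_hi))) as [d Hd].
exists d.
change (forall x : R, Rabs (x - lo) < d -> lo < x ->
    0 < s x /\ 0 <= circle_radius (U x) (s x) /\
    circle_power (a x) (b x) (U x) (s x) <= 0).
intros x Hx Hlx.
destruct (Hd x Hx Hlx) as (Sx & Dx & Rx & hx).
split; [exact Sx|]. split; [lra|].
set (G := fun t => circle_power (a t) (b t) (U t) (s t) / circle_radius (U t) (s t) * E t).
assert (HG : forall w, lo < w < x -> G x <= G w).
{ intros w Hw.
  assert (near : forall t, w <= t <= x -> lo <= t <= hi /\ 0 < s t /\
    0 < determinator_at (alpha t) (v t) (U t) (dU t) (s t) /\ 0 < circle_radius (U t) (s t)).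
  { intros t Ht. assert (Hlt : lo < t) by lra.
    assert (Hball : ball lo d t).
    { change (Rabs (t - lo) < d).
      rewrite Rabs_pos_eq in Hx |- *; lra. }
    destruct (Hd t Hball Hlt) as (A1 & A2 & A3 & A4). repeat split; lra. }
  destruct (MVT_gen G w x (fun t => - (determinator_at (alpha t) (v t) (U t) (dU t) (s t) * E t
        / (s t * circle_radius (U t) (s t) ^ 2)) * (a t ^ 2 + (b t - s t) ^ 2))) as [c [Hc HMVT]].
  - intros t. rewrite Rmin_left, Rmax_right by lra. intros Ht.
    destruct (near t ltac:(lra)) as (A1 & A2 & A3 & A4).
    apply (quotient_derive t fr A1); [lra|apply Hm; exact A1|lra].
  - intros t. rewrite Rmin_left, Rmax_right by lra. intros Ht.
    destruct (near t ltac:(lra)) as (A1 & A2 & A3 & A4).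
    apply continuity_pt_filterlim. eapply is_derive_continuous.
    apply (quotient_derive t fr A1); [lra|apply Hm; exact A1|lra].
  - rewrite Rmin_left, Rmax_right in Hc by lra.
    destruct (near c ltac:(lra)) as (A1 & A2 & A3 & A4).
    pose proof (frame_E_pos fr c) as Ec.
    assert (0 <= determinator_at (alpha c) (v c) (U c) (dU c) (s c) * E c
        / (s c * circle_radius (U c) (s c) ^ 2)).
    { apply Rmult_le_pos; [nra|]. left. apply Rinv_0_lt_compat.
      apply Rmult_lt_0_compat; [assumption|]. apply pow_lt; assumption. }
    assert (0 <= a c ^ 2 + (b c - s c) ^ 2) by (apply Rplus_le_le_0_compat; apply pow2_ge_0).
    set (k1 := determinator_at _ _ _ _ _ * E c / _) in *. set (k2 := a c ^ 2 + _) in *.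
    assert (0 <= k1 * k2 * (x - w))
      by (apply Rmult_le_pos; [apply Rmult_le_pos; assumption|lra]).
    lra. }
pose proof (frame_E_pos fr lo) as E0.
pose proof (frame_E_pos fr x) as Ex.
assert (HGx : G x <= 0).
{ apply Rnot_lt_le. intros Hpos.
  set (eps := G x / (2 * (E lo + 1))).
  assert (Heps : 0 < eps) by (apply Rdiv_lt_0_compat; lra).
  assert (ev_x : at_right lo (fun w => w < x)).
  { apply filter_le_within. apply open_lt. exact Hlx. }
  assert (ev_lo : at_right lo (fun w => lo < w)).
  { exists (mkposreal 1 Rlt_0_1). intros; assumption. }
  destruct (filter_ex (F := at_right lo) _ (filter_and _ _ (ev_F eps Heps)
    (filter_and _ _ ev_E (filter_and _ _ ev_R (filter_and _ _ ev_x ev_lo)))))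
    as [w (W1 & W2 & W3 & W4 & W5)].
  specialize (HG w ltac:(lra)).
  pose proof (frame_E_pos fr w) as Ew.
  assert (Hq : circle_power (a w) (b w) (U w) (s w) / circle_radius (U w) (s w) < eps).
  { apply Rmult_lt_reg_r with (circle_radius (U w) (s w)); [assumption|].
    replace (circle_power (a w) (b w) (U w) (s w) / circle_radius (U w) (s w)
      * circle_radius (U w) (s w))
      with (circle_power (a w) (b w) (U w) (s w)) by (field; lra). lra. }
  assert (G w <= eps * (E lo + 1)) by (unfold G; nra).
  assert (eps * (E lo + 1) = G x / 2) by (unfold eps; field; lra).
  lra. }
unfold G in HGx.
assert (Eq : circle_power (a x) (b x) (U x) (s x) =
  circle_power (a x) (b x) (U x) (s x) / circle_radius (U x) (s x) * E x
  * (circle_radius (U x) (s x) / E x))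
  by (field; lra).
rewrite Eq.
assert (0 < circle_radius (U x) (s x) / E x) by (apply Rdiv_lt_0_compat; assumption).
nra.
Qed.

(** * Monotone, possibly discontinuous, motion of the circle *)

Lemma real_induction (Q : R -> Prop) p q : p <= q -> Q p ->
  (forall x, p <= x < q -> Q x -> at_right x Q) ->
  (forall x, p < x <= q -> (forall y, p <= y < x -> Q y) -> Q x) ->
  Q q.
Proof.
intros Hpq H0 Hright Hleft.
set (A := fun x => p <= x <= q /\ forall y, p <= y <= x -> Q y).
assert (HA : A p).
{ split; [lra|]. intros y Hy. replace y with p by lra. exact H0. }
destruct (completeness A) as [m [Hub Hlub]].
- exists q. intros x [Hx _]. lra.
- exists p. exact HA.
- assert (Hpm : p <= m) by (apply Hub; exact HA).
  assert (Hmq : m <= q) by (apply Hlub; intros x [Hx _]; lra).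
  assert (Hbelow : forall y, p <= y < m -> Q y).
  { intros y Hy. apply NNPP. intros Hn.
    assert (m <= y); [|lra]. apply Hlub. intros x [Hx1 Hx2].
    destruct (Rle_or_lt x y) as [|Hyx]; [assumption|]. exfalso. apply Hn, Hx2. lra. }
  assert (Hm : Q m).
  { destruct Hpm as [Hpm|Hpm]; [|rewrite <- Hpm; exact H0].
    apply Hleft; [lra|exact Hbelow]. }
  destruct Hmq as [Hmq|Hmq]; [|rewrite <- Hmq; exact Hm].
  exfalso. destruct (Hright m ltac:(lra) Hm) as [d Hd].
  pose proof (cond_pos d) as Hd0.
  set (z := Rmin (m + d / 2) q).
  assert (Hz : m < z /\ z <= q /\ z <= m + d / 2).
  { unfold z. split; [apply Rmin_glb_lt; lra|split; [apply Rmin_r|apply Rmin_l]]. }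
  assert (z <= m); [|lra]. apply Hub. split; [lra|]. intros y Hy.
  destruct (Rlt_or_le m y) as [Hmy|Hmy].
  + apply Hd; [|exact Hmy]. change (Rabs (y - m) < d). rewrite Rabs_pos_eq; lra.
  + destruct Hmy as [Hmy|Hmy]; [apply Hbelow; lra|rewrite Hmy; exact Hm].
Qed.

Lemma nondecreasing_left_limit (g : R -> R) p q : p < q ->
  (forall x y, p <= x -> x <= y -> y <= q -> g x <= g y) ->
  exists l, filterlim g (at_left q) (locally l) /\ l <= g q.
Proof.
intros Hpq Hg.
destruct (completeness (fun z => exists x, p <= x < q /\ z = g x)) as [l [Hub Hlub]].
- exists (g q). intros z [x [Hx ->]]. apply Hg; lra.
- exists (g p), p. split; [lra|reflexivity].
- exists l. split.
  + intros V [eps HV].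
    assert (Hex : exists x, p <= x < q /\ l - eps < g x).
    { apply NNPP. intros Hn. assert (l <= l - eps); [|pose proof (cond_pos eps); lra].
      apply Hlub. intros z [x [Hx ->]]. apply Rnot_lt_le. intros Hlt.
      apply Hn. exists x. split; assumption. }
    destruct Hex as [x [Hx Hgx]].
    assert (Hd : 0 < q - x) by lra.
    exists (mkposreal _ Hd).
    change (forall y : R, Rabs (y - q) < q - x -> y < q -> V (g y)).
    intros y Hy Hyq. apply HV. change (Rabs (g y - l) < eps).
    rewrite Rabs_left in Hy by lra.
    assert (g x <= g y) by (apply Hg; lra).
    assert (g y <= l) by (apply Hub; exists y; split; [lra|reflexivity]).
    apply Rabs_def1; pose proof (cond_pos eps); lra.
  + apply Hlub. intros z [x [Hx ->]]. apply Hg; lra.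
Qed.

Ltac solve_filterlim :=
  repeat (first
    [ assumption
    | apply filterlim_const
    | eapply (filterlim_comp_2 (H := locally _));
        [| |apply (filterlim_plus (V := R_NormedModule))]
    | eapply (filterlim_comp_2 (H := locally _));
        [| |apply (filterlim_mult (K := R_AbsRing))]
    | eapply (filterlim_comp _ _ _ _ Ropp);
        [|apply (filterlim_opp (V := R_NormedModule))]
    | eapply (filterlim_comp _ _ _ _ Rinv);
        [|apply continuous_Rinv; assumption]]).

Lemma power_closed_limit (F : (R -> Prop) -> Prop) {HF : ProperFilter F}
  (a b U s : R -> R) (a0 b0 U0 s0 : R) :
  filterlim a F (locally a0) -> filterlim b F (locally b0) ->
  filterlim U F (locally U0) -> filterlim s F (locally s0) -> s0 <> 0 ->
  F (fun x => circle_power (a x) (b x) (U x) (s x) <= 0) -> circle_power a0 b0 U0 s0 <= 0.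
Proof.
intros Ha Hb HU Hs Hs0 Hle.
assert (Hlim : filterlim (fun x => circle_power (a x) (b x) (U x) (s x)) F
   (locally (circle_power a0 b0 U0 s0))).
{ unfold circle_power, circle_height, Rdiv, Rminus. simpl.
  solve_filterlim. }
exact (filterlim_le (F := F) _ (fun _ => 0) (Finite (circle_power a0 b0 U0 s0)) (Finite 0)
  Hle Hlim (filterlim_const 0)).
Qed.

Lemma radius_closed_limit (F : (R -> Prop) -> Prop) {HF : ProperFilter F}
  (U s : R -> R) (U0 s0 : R) :
  filterlim U F (locally U0) -> filterlim s F (locally s0) -> s0 <> 0 ->
  F (fun x => 0 <= circle_radius (U x) (s x)) -> 0 <= circle_radius U0 s0.
Proof.
intros HU Hs Hs0 Hle.
assert (Hlim : filterlim (fun x => circle_radius (U x) (s x)) F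
   (locally (circle_radius U0 s0))).
{ unfold circle_radius, Rdiv.
  solve_filterlim. }
exact (filterlim_le (F := F) (fun _ => 0) _ (Finite 0) (Finite (circle_radius U0 s0))
  Hle (filterlim_const 0) Hlim).
Qed.

Lemma at_left_continuous (f : R -> R) x : continuous f x ->
  filterlim f (at_left x) (locally (f x)).
Proof. intros Hf. eapply filterlim_filter_le_1; [apply filter_le_within|exact Hf]. Qed.

Lemma at_left_between p x : p < x -> at_left x (fun y => p <= y < x).
Proof.
intros H. assert (Hd : 0 < x - p) by lra. exists (mkposreal _ Hd).
change (forall y : R, Rabs (y - x) < x - p -> y < x -> p <= y < x).
intros y Hy Hyx. rewrite Rabs_left in Hy by lra. lra.
Qed.

Lemma riccati_frame_restrict lo hi lo' alpha v a b U dU sigma P E : lo <= lo' ->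
  riccati_frame lo hi alpha v a b U dU sigma P E ->
  riccati_frame lo' hi alpha v a b U dU sigma P E.
Proof.
intros Hl []; constructor; intros; auto;
  match goal with H : _ |- _ => apply H; lra end.
Qed.

(** The real function S is merely such that sigma S - P is nondecreasing.  The
    frozen top s with the same value as S at p is at most S to the right of p,
    and the left limit of S is at most S; in both cases [power_mono] turns a
    bound for the lower circle into one for the actual circle. *)
Lemma disc_propagates lo hi alpha v a b U dU sigma P E S : lo < hi ->
  riccati_frame lo hi alpha v a b U dU sigma P E ->
  (forall x y, lo <= x -> x <= y -> y <= hi ->
     sigma x * S x - P x <= sigma y * S y - P y) ->
  (forall x, lo <= x <= hi -> 0 < S x) ->
  (forall x, lo <= x <= hi -> 0 <= circle_radius (U x) (S x)) ->
  (forall x, lo <= x <= hi -> 0 < determinator_at (alpha x) (v x) (U x) (dU x) (S x)) ->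
  circle_power (a lo) (b lo) (U lo) (S lo) <= 0 ->
  circle_power (a hi) (b hi) (U hi) (S hi) <= 0.
Proof.
intros Hlh fr Hmono HS HR HD H0.
apply (real_induction (fun x => circle_power (a x) (b x) (U x) (S x) <= 0) lo);
  [lra|exact H0| |].
- intros p Hp HF.
  set (T := sigma p * S p - P p).
  set (s := fun x => (T + P x) / sigma x).
  assert (fr' := riccati_frame_restrict lo hi p _ _ _ _ _ _ _ _ _ ltac:(lra) fr).
  pose proof (frame_sigma_pos fr) as Hsig.
  assert (Hsp : s p = S p).
  { unfold s, T. field. pose proof (Hsig p). lra. }
  assert (Hm : forall x, p <= x <= hi -> frozen_top alpha v s x).
  { intros x Hx. unfold frozen_top, s.
    pose proof (frame_sigma fr' x Hx) as dsig.
    pose proof (frame_P fr' x Hx) as dP.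
    pose proof (Hsig x) as Hx0.
    auto_derive.
    - repeat split; try (eexists; eassumption). lra.
    - rewrite (is_derive_unique (fun t : R => sigma t) _ _ dsig),
        (is_derive_unique (fun t : R => P t) _ _ dP).
      field. lra. }
  assert (Hstep := frozen_step s fr' (proj2 Hp) Hm).
  rewrite Hsp in Hstep.
  specialize (Hstep (HS p ltac:(lra)) (HR p ltac:(lra)) (HD p ltac:(lra)) HF).
  assert (ev_hi : at_right p (fun x => x < hi)).
  { apply filter_le_within. apply open_lt. apply Hp. }
  assert (ev_p : at_right p (fun x => p < x)).
  { exists (mkposreal 1 Rlt_0_1). intros; assumption. }
  generalize (filter_and _ _ Hstep (filter_and _ _ ev_hi ev_p)).
  apply filter_imp. intros x ((s0 & r0 & f0) & xh & xp).
  apply power_mono with (s x); try assumption.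
  + apply (frame_b_pos fr). lra.
  + pose proof (Hmono p x ltac:(lra) ltac:(lra) ltac:(lra)) as HT.
    pose proof (Hsig x) as Hx0.
    apply Rmult_le_reg_l with (sigma x); [assumption|].
    replace (sigma x * s x) with (T + P x) by (unfold s; field; lra).
    unfold T. lra.
- intros x Hx Hbefore.
  pose proof (frame_sigma_pos fr) as Hsig.
  assert (Hxx : lo <= x <= hi) by lra.
  assert (Ca := is_derive_continuous _ _ _ (frame_a fr x Hxx)).
  assert (Cb := is_derive_continuous _ _ _ (frame_b fr x Hxx)).
  assert (CU := is_derive_continuous _ _ _ (frame_U fr x Hxx)).
  assert (Csig := is_derive_continuous _ _ _ (frame_sigma fr x Hxx)).
  assert (CP := is_derive_continuous _ _ _ (frame_P fr x Hxx)).
  apply at_left_continuous in Ca, Cb, CU, Csig, CP.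
  destruct (nondecreasing_left_limit (fun t => sigma t * S t - P t) lo x ltac:(lra))
    as [l [Hl Hlx]].
  { intros t t' A1 A2 A3. apply Hmono; lra. }
  pose proof (Hsig x) as Hx0.
  set (s := (l + P x) / sigma x).
  assert (Hs : filterlim S (at_left x) (locally s)).
  { apply filterlim_ext with (fun t => (sigma t * S t - P t + P t) * / sigma t).
    - intros t. pose proof (Hsig t). field. lra.
    - unfold s, Rdiv.
      eapply (filterlim_comp_2 (H := locally _)); [| |apply (filterlim_mult (K := R_AbsRing))].
      + eapply (filterlim_comp_2 (H := locally _));
          [exact Hl|exact CP|apply (filterlim_plus (V := R_NormedModule))].
      + eapply (filterlim_comp _ _ _ _ Rinv); [exact Csig|apply continuous_Rinv; lra]. }
  assert (ev := at_left_between lo x ltac:(lra)).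
  (* This keeps the left limit of S away from 0, although S itself may a priori
     tend to 0 from the left. *)
  assert (Hbs : b x <= s).
  { apply (filterlim_le (F := at_left x) b S (Finite (b x)) (Finite s)); [|exact Cb|exact Hs].
    generalize ev. apply filter_imp. intros t Ht.
    apply top_of_member with (a t) (U t); [apply HS|apply HR|apply Hbefore]; lra. }
  pose proof (frame_b_pos fr x Hxx) as Hb0.
  apply power_mono with s; [exact Hb0|lra| | |].
  + apply Rmult_le_reg_l with (sigma x); [assumption|].
    replace (sigma x * s) with (l + P x) by (unfold s; field; lra). lra.
  + apply (radius_closed_limit (at_left x) U S); [exact CU|exact Hs|lra|].
    generalize ev. apply filter_imp. intros t Ht. apply HR; lra.
  + apply (power_closed_limit (at_left x) a b U S); [exact Ca|exact Cb|exact CU|exact Hs|lra|].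
    generalize ev. apply filter_imp. intros t Ht. apply Hbefore; lra.
Qed.

(** * Differentiation relative to an interval *)

Lemma within_self_proper (I : R -> Prop) x : I x -> ProperFilter (within I (locally x)).
Proof.
intros Hx. constructor; [|apply within_filter; apply locally_filter].
intros Q [eps HQ]. exists x. apply HQ; [apply ball_center|exact Hx].
Qed.

Lemma within_self_lim (I : R -> Prop) x : is_filter_lim (within I (locally x)) x.
Proof. intros Q HQ. apply filter_le_within. exact HQ. Qed.

Lemma is_derive_on_continuous {E : NormedModule R_AbsRing} (I : R -> Prop) (f : R -> E) x l :
  is_derive_on I f x l -> filterlim f (within I (locally x)) (locally (f x)).
Proof.
intros Hf. apply filterdiff_continuous_aux; [|apply within_self_lim].
eexists. exact Hf.
Qed.

Lemma is_derive_on_comp {E E' : NormedModule R_AbsRing} (I : R -> Prop)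
  (f : R -> E) (h : E -> E') (lh : E -> E') x l : I x ->
  filterdiff h (locally (f x)) lh ->
  is_derive_on I f x l -> is_derive_on I (fun t => h (f t)) x (lh l).
Proof.
intros Hx Hh Hf. unfold is_derive_on.
pose proof (within_self_proper I x Hx) as PF.
apply filterdiff_ext_lin with (fun t => lh (scal t l)).
- apply filterdiff_comp; [exact Hf|].
  apply filterdiff_locally with (f x); [|exact Hh].
  exact (is_derive_on_continuous I f x l Hf).
- intros t. destruct Hh as [Hlin _]. exact (linear_scal lh Hlin t l).
Qed.

Lemma is_derive_on_ext {E : NormedModule R_AbsRing} (I : R -> Prop) (f h : R -> E) x l :
  I x -> (forall t, I t -> f t = h t) -> is_derive_on I f x l -> is_derive_on I h x l.
Proof.
intros Hx Hfh. apply filterdiff_ext_loc.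
- exists (mkposreal 1 Rlt_0_1). intros y _ Hy. apply Hfh, Hy.
- intros x' Hx'. pose proof (within_self_proper I x Hx) as PF.
  replace x' with x; [apply Hfh, Hx|].
  eapply (is_filter_lim_unique (F := within I (locally x))); [apply within_self_lim|exact Hx'].
Qed.

Lemma is_derive_on_minus (I : R -> Prop) (f h : R -> R) x lf lh :
  is_derive_on I f x lf -> is_derive_on I h x lh ->
  is_derive_on I (fun t => f t - h t) x (lf - lh).
Proof.
intros Hf Hh. unfold is_derive_on.
apply filterdiff_ext_lin with (fun t => minus (scal t lf) (scal t lh)).
- apply (filterdiff_minus_fct f h); assumption.
- intros t. symmetry. apply (scal_minus_distr_l (V := R_NormedModule)).
Qed.

Lemma is_derive_on_interior (I : R -> Prop) (f : R -> R) x l : locally x I ->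
  is_derive_on I f x l -> is_derive f x l.
Proof.
intros HI [Hlin Hdom]. split; [exact Hlin|].
intros x' Hx' eps.
specialize (Hdom x' (is_filter_lim_filter_le x' (filter_le_within I) Hx') eps).
generalize (filter_and _ _ HI Hdom). apply filter_imp. intros y [Hy Hy']. apply Hy', Hy.
Qed.

Lemma is_derive_on_quotient (I : R -> Prop) (f : R -> R) x l : I x ->
  is_derive_on I f x l -> forall eps, 0 < eps ->
  exists d, 0 < d /\ forall y, I y -> Rabs (y - x) < d ->
    Rabs (f y - f x - (y - x) * l) <= eps * Rabs (y - x).
Proof.
intros Hx [_ Hdom] eps Heps.
destruct (Hdom x (within_self_lim I x) (mkposreal eps Heps)) as [d Hd].
exists d. split; [apply cond_pos|]. intros y Hy Hyx. exact (Hd y Hyx Hy).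
Qed.

(** Every point of the interval is approached by other points of it, because
    the interval has two distinct points. *)
Lemma is_derive_on_unique (I : R -> Prop) (f : R -> R) x l l' : is_interval I -> I x ->
  is_derive_on I f x l -> is_derive_on I f x l' -> l = l'.
Proof.
intros [Hconn (p & q & Hp & Hq & Hpq)] Hx Hl Hl'.
destruct (Req_dec l l') as [|Hne]; [assumption|exfalso].
set (eps := Rabs (l - l') / 4).
assert (Heps : 0 < eps) by (unfold eps; pose proof (Rabs_pos_lt (l - l')); lra).
destruct (is_derive_on_quotient I f x l Hx Hl eps Heps) as (d & Hd & H1).
destruct (is_derive_on_quotient I f x l' Hx Hl' eps Heps) as (d' & Hd' & H2).
assert (Hy : exists y, I y /\ y <> x /\ Rabs (y - x) < d /\ Rabs (y - x) < d').
{ set (r := Rmin d d' / 2).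
  assert (Hr : 0 < r /\ r < d /\ r < d').
  { unfold r. pose proof (Rmin_l d d'). pose proof (Rmin_r d d').
    assert (0 < Rmin d d') by (apply Rmin_glb_lt; lra). lra. }
  destruct (Rlt_or_le x q) as [Hxq|Hxq].
  - exists (Rmin (x + r) q).
    assert (x < Rmin (x + r) q) by (apply Rmin_glb_lt; lra).
    pose proof (Rmin_l (x + r) q). pose proof (Rmin_r (x + r) q).
    split; [apply (Hconn x q); [assumption|assumption|lra]|].
    rewrite Rabs_pos_eq by lra. repeat split; lra.
  - exists (Rmax (x - r) p).
    assert (Rmax (x - r) p < x) by (apply Rmax_lub_lt; lra).
    pose proof (Rmax_l (x - r) p). pose proof (Rmax_r (x - r) p).
    split; [apply (Hconn p x); [assumption|assumption|lra]|].
    rewrite Rabs_left by lra. repeat split; lra. }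
destruct Hy as (y & Iy & Hyx & Y1 & Y2).
specialize (H1 y Iy Y1). specialize (H2 y Iy Y2).
assert (Hpos : 0 < Rabs (y - x)) by (apply Rabs_pos_lt; lra).
assert (Hbound : Rabs ((y - x) * (l - l')) <= 2 * eps * Rabs (y - x)).
{ replace ((y - x) * (l - l')) with
    ((f y - f x - (y - x) * l') + - (f y - f x - (y - x) * l)) by ring.
  eapply Rle_trans; [apply Rabs_triang|]. rewrite Rabs_Ropp. lra. }
rewrite Rabs_mult in Hbound. unfold eps in *.
assert (0 < Rabs (l - l')) by lra. nra.
Qed.

Lemma Derive_on_eq (I : R -> Prop) (f : R -> R) x l : is_interval I -> I x ->
  is_derive_on I f x l -> Derive_on I f x = l.
Proof.
intros HI Hx Hl. apply (iota_unique (V := R_CompleteNormedModule)); [|exact Hl].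
intros l' Hl'. exact (is_derive_on_unique I f x l' l HI Hx Hl' Hl).
Qed.

Definition clamp (c d x : R) : R := Rmax c (Rmin d x).

Lemma clamp_in c d x : c <= d -> c <= clamp c d x <= d.
Proof. intros H. unfold clamp, Rmax, Rmin. repeat destruct Rle_dec; lra. Qed.

Lemma clamp_id c d x : c <= x <= d -> clamp c d x = x.
Proof. intros H. unfold clamp, Rmax, Rmin. repeat destruct Rle_dec; lra. Qed.

Lemma clamp_lipschitz c d x y : c <= d -> Rabs (clamp c d y - clamp c d x) <= Rabs (y - x).
Proof.
intros H. unfold clamp, Rmax, Rmin.
repeat destruct Rle_dec; unfold Rabs; repeat destruct Rcase_abs; lra.
Qed.

Lemma clamp_continuous {T : UniformSpace} (I : R -> Prop) (f : R -> T) c d : c <= d ->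
  (forall x, c <= x <= d -> I x) -> continuous_on I f ->
  forall x, continuous (fun t => f (clamp c d t)) x.
Proof.
intros Hcd HI Hf x.
eapply (filterlim_comp _ _ _ (clamp c d)); [|apply Hf, HI, clamp_in, Hcd].
intros Q [eps HQ]. exists eps. intros y Hy. apply HQ; [|apply HI, clamp_in, Hcd].
eapply Rle_lt_trans; [apply clamp_lipschitz, Hcd|exact Hy].
Qed.

Lemma continuous_ex_RInt (f : R -> R) : (forall x, continuous f x) ->
  forall x y, ex_RInt f x y.
Proof. intros Hf x y. apply (ex_RInt_continuous f). intros; apply Hf. Qed.

Lemma is_derive_primitive (f : R -> R) p : (forall x, continuous f x) ->
  forall x, is_derive (fun t => RInt f p t) x (f x).
Proof.
intros Hf x. apply (is_derive_RInt f _ p); [|apply Hf].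
apply filter_forall. intros t. apply (RInt_correct f), continuous_ex_RInt, Hf.
Qed.

Lemma constant_on_segment (f : R -> R) c d :
  (forall x, c < x < d -> is_derive f x 0) ->
  (forall x, c <= x <= d -> continuous f x) ->
  forall x y, c <= x <= d -> c <= y <= d -> f x = f y.
Proof.
intros Hd Hc x y Hx Hy.
destruct (MVT_gen f x y (fun _ => 0)) as [z [_ Hz]].
- intros t Ht. apply Hd. revert Ht. unfold Rmin, Rmax. destruct Rle_dec; lra.
- intros t Ht. apply continuity_pt_filterlim, Hc.
  revert Ht. unfold Rmin, Rmax. destruct Rle_dec; lra.
- lra.
Qed.

(** A continuously differentiable function on a segment, with one-sided
    derivatives at the end points, extends to a differentiable function on the
    line: integrate the derivative continued by constants.  This lets the
    two-sided calculus apply on closed segments. *)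
Lemma differentiable_extension (I : R -> Prop) c d (f f' : R -> R) : c < d ->
  (forall x, c <= x <= d -> I x) ->
  (forall x, I x -> is_derive_on I f x (f' x)) ->
  (forall x, continuous (fun t => f' (clamp c d t)) x) ->
  exists F, (forall x, is_derive F x (f' (clamp c d x))) /\
    (forall x, c <= x <= d -> F x = f x).
Proof.
intros Hcd HI Hf Hf'.
assert (Hfc : forall x, continuous (fun t => f (clamp c d t)) x).
{ apply (clamp_continuous I); [lra|exact HI|].
  intros x Hx. exact (is_derive_on_continuous I f x _ (Hf x Hx)). }
set (J := fun x : R => RInt (fun t => f' (clamp c d t)) c x : R).
assert (HJ : forall x, is_derive J x (f' (clamp c d x))).
{ intros x. apply (is_derive_primitive (fun t => f' (clamp c d t)) c Hf'). }
exists (fun x => f c + J x). split.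
- intros x. evar_last; [apply (is_derive_plus (fun _ => f c) J);
    [apply is_derive_const|apply HJ]|].
  apply plus_zero_l.
- intros x Hx.
  assert (Hconst : (fun t => f (clamp c d t) - J t) c = (fun t => f (clamp c d t) - J t) x).
  { apply (constant_on_segment (fun t => f (clamp c d t) - J t) c d); [| |lra|exact Hx].
    - intros t Ht. evar_last.
      + apply (is_derive_minus (fun t => f (clamp c d t)) J); [|apply HJ].
        apply (is_derive_ext_loc f).
        * apply (filter_imp (fun z => c < z < d)).
          -- intros z Hz. rewrite clamp_id by lra. reflexivity.
          -- apply (open_and _ _ (open_gt c) (open_lt d)). exact Ht.
        * apply (is_derive_on_interior I); [|apply Hf, HI; lra].
          apply (filter_imp (fun z => c < z < d)); [intros z Hz; apply HI; lra|].
          apply (open_and _ _ (open_gt c) (open_lt d)). exact Ht.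
      + rewrite clamp_id by lra. apply (minus_eq_zero (G := R_AbelianGroup)).
    - intros t Ht. apply (continuous_minus (fun t => f (clamp c d t)) J); [apply Hfc|].
      eapply is_derive_continuous, HJ. }
  simpl in Hconst. rewrite !clamp_id in Hconst by lra.
  assert (Jc : J c = 0) by (apply (RInt_point (V := R_CompleteNormedModule))).
  lra.
Qed.

Lemma RInt_clamp (f : R -> R) c d p x : c <= p <= d -> c <= x <= d ->
  RInt f p x = RInt (fun t => f (clamp c d t)) p x.
Proof.
intros Hp Hx. apply (RInt_ext f). intros t Ht. rewrite clamp_id; [reflexivity|].
revert Ht. unfold Rmin, Rmax. destruct Rle_dec; lra.
Qed.

(** * The Riccati equation in real coordinates *)

Lemma is_derive_on_Re (I : R -> Prop) (f : R -> C) x l : I x ->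
  is_derive_on (E := C_R_NormedModule) I f x l ->
  is_derive_on I (fun t => Re (f t)) x (Re l).
Proof.
intros Hx Hf.
apply (is_derive_on_comp (E := C_R_NormedModule) (E' := R_NormedModule) I f
  (fun z => fst z) (fun z => fst z)); [exact Hx| |exact Hf].
apply (filterdiff_linear (U := prod_NormedModule R_AbsRing R_NormedModule R_NormedModule)).
apply (is_linear_fst (U := R_NormedModule) (V := R_NormedModule)).
Qed.

Lemma is_derive_on_Im (I : R -> Prop) (f : R -> C) x l : I x ->
  is_derive_on (E := C_R_NormedModule) I f x l ->
  is_derive_on I (fun t => Im (f t)) x (Im l).
Proof.
intros Hx Hf.
apply (is_derive_on_comp (E := C_R_NormedModule) (E' := R_NormedModule) I f
  (fun z => snd z) (fun z => snd z)); [exact Hx| |exact Hf].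
apply (filterdiff_linear (U := prod_NormedModule R_AbsRing R_NormedModule R_NormedModule)).
apply (is_linear_snd (U := R_NormedModule) (V := R_NormedModule)).
Qed.

Lemma continuous_on_Re (I : R -> Prop) (f : R -> C) :
  continuous_on (U := C_R_NormedModule) I f -> continuous_on I (fun t => Re (f t)).
Proof.
intros Hf x Hx. apply (filterlim_comp _ _ _ f (fun z : C => fst z) _ _ _ (Hf x Hx)).
apply (continuous_fst (U := R_UniformSpace) (V := R_UniformSpace)).
Qed.

Lemma continuous_on_Im (I : R -> Prop) (f : R -> C) :
  continuous_on (U := C_R_NormedModule) I f -> continuous_on I (fun t => Im (f t)).
Proof.
intros Hf x Hx. apply (filterlim_comp _ _ _ f (fun z : C => snd z) _ _ _ (Hf x Hx)).
apply (continuous_snd (U := R_UniformSpace) (V := R_UniformSpace)).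
Qed.

Lemma C1_on_continuous_on (I : R -> Prop) (f : R -> C) :
  C1_on (E := C_R_NormedModule) I f -> continuous_on (U := C_R_NormedModule) I f.
Proof.
intros (f' & Hf & _) x Hx. exact (is_derive_on_continuous I f x (f' x) (Hf x Hx)).
Qed.

Lemma riccati_Re I V y x : I x -> riccati_solution I V y ->
  is_derive_on I (fun t => Re (y t)) x (Re (V x) - Re (y x) ^ 2 + Im (y x) ^ 2).
Proof.
intros Hx Hy. replace (Re (V x) - Re (y x) ^ 2 + Im (y x) ^ 2) with (Re (V x - y x * y x)%C).
- apply is_derive_on_Re; [exact Hx|apply Hy, Hx].
- unfold Re, Im; simpl. ring.
Qed.

Lemma riccati_Im I V y x : I x -> riccati_solution I V y ->
  is_derive_on I (fun t => Im (y t)) x (Im (V x) - 2 * Re (y x) * Im (y x)).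
Proof.
intros Hx Hy. replace (Im (V x) - 2 * Re (y x) * Im (y x)) with (Im (V x - y x * y x)%C).
- apply is_derive_on_Im; [exact Hx|apply Hy, Hx].
- unfold Re, Im; simpl. ring.
Qed.

(** The Riccati equation of alpha + i betat gives
    alpha' = Re Vt - alpha^2 + betat^2.  In particular U involves no derivative
    any more, and is differentiable with V and Vt although alpha' occurs in its definition. *)
Lemma Ufun_eq I V Vt alpha betat x : is_interval I -> I x ->
  riccati_solution I Vt (fun u => (alpha u, betat u) : C) ->
  Ufun I V alpha x = Re (V x) - Re (Vt x) - betat x ^ 2.
Proof.
intros HI Hx Hyt. unfold Ufun.
rewrite (Derive_on_eq I alpha x _ HI Hx (riccati_Re I Vt _ x Hx Hyt)).
simpl. ring.
Qed.

Lemma Ufun_derive I V V' Vt Vt' alpha betat x : is_interval I -> I x ->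
  riccati_solution I Vt (fun u => (alpha u, betat u) : C) ->
  is_derive_on (E := C_R_NormedModule) I V x V' ->
  is_derive_on (E := C_R_NormedModule) I Vt x Vt' ->
  is_derive_on I (Ufun I V alpha) x
    (Re V' - Re Vt' - 2 * betat x * (Im (Vt x) - 2 * alpha x * betat x)).
Proof.
intros HI Hx Hyt HV HVt.
apply is_derive_on_ext with (fun t => (Re (V t) - Re (Vt t)) - betat t ^ 2).
- exact Hx.
- intros t Ht. rewrite (Ufun_eq I V Vt alpha betat t HI Ht Hyt).
  reflexivity.
- replace (2 * betat x * (Im (Vt x) - 2 * alpha x * betat x))
    with (scal (Im (Vt x) - 2 * alpha x * betat x) (2 * betat x))
    by (unfold scal; simpl; unfold mult; simpl; ring).
  apply is_derive_on_minus; [apply is_derive_on_minus|].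
  + apply is_derive_on_Re; assumption.
  + apply is_derive_on_Re; assumption.
  + apply (is_derive_on_comp (E := R_NormedModule) (E' := R_NormedModule) I betat
      (fun z => z ^ 2) (fun h => scal h (2 * betat x)) x _ Hx);
      [|exact (riccati_Im I Vt _ x Hx Hyt)].
    change (is_derive (fun z => z ^ 2) (betat x) (2 * betat x)).
    auto_derive; [exact Logic.I|ring].
Qed.

Lemma disc_iff_power (z : C) alpha beta r : 0 <= r ->
  (Cmod (z - (alpha, beta))%C <= r <->
   (Re z - alpha) ^ 2 + Im z ^ 2 - (r ^ 2 - beta ^ 2) - 2 * Im z * beta <= 0).
Proof.
intros Hr. unfold Cmod. destruct z as [p q]. simpl.
rewrite <- (sqrt_pow2 r Hr) at 1.
match goal with |- sqrt ?e <= _ <-> _ => set (w := e) end.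
assert (Hw : w = (p - alpha) ^ 2 + (q - beta) ^ 2) by (unfold w; ring).
assert (0 <= w) by (rewrite Hw; apply Rplus_le_le_0_compat; apply pow2_ge_0).
split; intros H0.
- apply sqrt_le_0 in H0; [|assumption|apply pow2_ge_0]. unfold Re, Im; simpl. nra.
- apply sqrt_le_1_alt. unfold Re, Im in H0; simpl in H0. nra.
Qed.

Ltac solve_continuous :=
  repeat match goal with
  | |- continuous (fun _ => ?c) _ => apply continuous_const
  | |- continuous (fun t => @?f t + @?h t) _ => apply (continuous_plus f h)
  | |- continuous (fun t => @?f t - @?h t) _ => apply (continuous_minus f h)
  | |- continuous (fun t => @?f t * @?h t) _ => apply (continuous_mult f h)
  | |- continuous (fun t => @?f t ^ 2) _ =>
      apply (continuous_ext (fun t => f t * f t)); [intros; simpl; ring|]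
  | H : forall x, continuous ?f x |- continuous ?f _ => exact (H _)
  end.

Lemma is_derive_exp_primitive (f : R -> R) p : (forall x, continuous f x) ->
  forall x, is_derive (fun t => exp (RInt (fun z => 2 * f z) p t)) x
    (2 * f x * exp (RInt (fun z => 2 * f z) p x)).
Proof.
intros Hf x.
assert (H : is_derive (fun t => RInt (fun z => 2 * f z) p t) x (2 * f x)).
{ apply (is_derive_primitive (fun z => 2 * f z)). intros t. solve_continuous. }
apply (is_derive_comp exp (fun t => RInt (fun z => 2 * f z) p t)); [|exact H].
apply is_derive_exp.
Qed.

(** * Invariance of the disc *)

(** All data are moved to a segment [c, d] that contains the base point, u0 and
    u1, and extended from there to the line.  The point is that the integral in
    kappa and the equation betat' = Im Vt - 2 alpha betat combine to
    sigma S - P = g + const, so that the circle meets the hypotheses of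
    [disc_propagates]. *)
Lemma disc_invariant (I : R -> Prop) (hI : is_interval I) (base : R) (hbase : I base)
  (V Vt : R -> C)
  (hV : C1_on (E := C_R_NormedModule) I V)
  (hVt : C1_on (E := C_R_NormedModule) I Vt)
  (alpha betat g S : R -> R) (y : R -> C) (u0 u1 : R) :
  riccati_solution I Vt (fun u => (alpha u, betat u) : C) ->
  (forall u v : R, I u -> I v -> u <= v -> g u <= g v) ->
  (forall u, I u -> S u = betat u + kappa base V Vt alpha g u) ->
  (forall u, I u -> 0 < S u) ->
  (forall u, I u -> 0 <= circle_radius (Ufun I V alpha u) (S u)) ->
  (forall u, I u -> 0 < determinator I V alpha
     (fun t => circle_height (Ufun I V alpha t) (S t)) u) ->
  riccati_solution I V y -> (forall u, I u -> 0 < Im (y u)) ->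
  I u0 -> I u1 -> u0 < u1 ->
  circle_power (Re (y u0) - alpha u0) (Im (y u0)) (Ufun I V alpha u0) (S u0) <= 0 ->
  circle_power (Re (y u1) - alpha u1) (Im (y u1)) (Ufun I V alpha u1) (S u1) <= 0.
Proof.
intros hyt hg hS hSpos hR hD hy hyim hu0 hu1 h01 hstart.
pose proof hV as (V' & HV' & CV'). pose proof hVt as (Vt' & HVt' & CVt').
set (c := Rmin base u0). set (d := Rmax base u1).
assert (hcd : c <= base <= d /\ c <= u0 /\ u1 <= d).
{ unfold c, d, Rmin, Rmax. repeat destruct Rle_dec; lra. }
assert (cd : c < d) by lra.
assert (HI : forall x, c <= x <= d -> I x).
{ intros x Hx. apply (proj1 hI c d); [| |exact Hx].
  - unfold c, Rmin. destruct Rle_dec; assumption.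
  - unfold d, Rmax. destruct Rle_dec; assumption. }
pose proof (clamp_continuous I (fun t => Re (V t)) c d (Rlt_le _ _ cd) HI
  (continuous_on_Re I V (C1_on_continuous_on I V hV))) as cV1.
pose proof (clamp_continuous I (fun t => Im (V t)) c d (Rlt_le _ _ cd) HI
  (continuous_on_Im I V (C1_on_continuous_on I V hV))) as cV2.
pose proof (clamp_continuous I (fun t => Re (Vt t)) c d (Rlt_le _ _ cd) HI
  (continuous_on_Re I Vt (C1_on_continuous_on I Vt hVt))) as cVt1.
pose proof (clamp_continuous I (fun t => Im (Vt t)) c d (Rlt_le _ _ cd) HI
  (continuous_on_Im I Vt (C1_on_continuous_on I Vt hVt))) as cVt2.
pose proof (clamp_continuous I (fun t => Re (V' t)) c d (Rlt_le _ _ cd) HI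
  (continuous_on_Re I V' CV')) as cV1'.
pose proof (clamp_continuous I (fun t => Re (Vt' t)) c d (Rlt_le _ _ cd) HI
  (continuous_on_Re I Vt' CVt')) as cVt1'.
assert (Cyt : continuous_on (U := C_R_NormedModule) I (fun u => (alpha u, betat u) : C)).
{ intros x Hx. exact (is_derive_on_continuous I _ x _ (hyt x Hx)). }
assert (Cy : continuous_on (U := C_R_NormedModule) I y).
{ intros x Hx. exact (is_derive_on_continuous I _ x _ (hy x Hx)). }
pose proof (clamp_continuous I alpha c d (Rlt_le _ _ cd) HI
  (continuous_on_Re I _ Cyt)) as ca.
pose proof (clamp_continuous I betat c d (Rlt_le _ _ cd) HI
  (continuous_on_Im I _ Cyt)) as cb.
pose proof (clamp_continuous I (fun t => Re (y t)) c d (Rlt_le _ _ cd) HI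
  (continuous_on_Re I _ Cy)) as cy1.
pose proof (clamp_continuous I (fun t => Im (y t)) c d (Rlt_le _ _ cd) HI
  (continuous_on_Im I _ Cy)) as cy2.
pose (al := fun t => alpha (clamp c d t)).
pose (vh := fun t => Im (V (clamp c d t))).
pose (sg := fun x => exp (RInt (fun t => 2 * al t) base x)).
pose (E := fun x => exp (RInt (fun t => 2 * Re (y (clamp c d t))) base x)).
assert (dsg : forall x, is_derive sg x (2 * al x * sg x)).
{ apply (is_derive_exp_primitive al base). exact ca. }
assert (dE : forall x, is_derive E x (2 * Re (y (clamp c d x)) * E x)).
{ apply (is_derive_exp_primitive (fun t => Re (y (clamp c d t))) base). exact cy1. }
assert (csg : forall x, continuous sg x).
{ intros x. eapply is_derive_continuous, dsg. }
pose (P := fun x => RInt (fun t => sg t * vh t) base x).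
pose (W := fun x => RInt (fun t => sg t * (vh t - Im (Vt (clamp c d t)))) base x).
assert (dP : forall x, is_derive P x (sg x * vh x)).
{ apply (is_derive_primitive (fun t => sg t * vh t)). unfold vh. intros x. solve_continuous. }
assert (dW : forall x, is_derive W x (sg x * (vh x - Im (Vt (clamp c d x))))).
{ apply (is_derive_primitive (fun t => sg t * (vh t - Im (Vt (clamp c d t))))).
  unfold vh. intros x. solve_continuous. }
destruct (differentiable_extension I c d (Ufun I V alpha)
  (fun x => Re (V' x) - Re (Vt' x) - 2 * betat x * (Im (Vt x) - 2 * alpha x * betat x))
  cd HI) as (U & dU & eU).
{ intros x Hx. apply Ufun_derive; auto. }
{ intros x. solve_continuous. }
destruct (differentiable_extension I c d betat
  (fun x => Im (Vt x) - 2 * alpha x * betat x) cd HI) as (bt & dbt & ebt).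
{ intros x Hx. exact (riccati_Im I Vt _ x Hx hyt). }
{ intros x. solve_continuous. }
destruct (differentiable_extension I c d (fun t => Im (y t))
  (fun x => Im (V x) - 2 * Re (y x) * Im (y x)) cd HI) as (b & db & eb).
{ intros x Hx. exact (riccati_Im I V _ x Hx hy). }
{ intros x. solve_continuous. }
destruct (differentiable_extension I c d (fun t => Re (y t) - alpha t)
  (fun x => (Re (V x) - Re (y x) ^ 2 + Im (y x) ^ 2) -
     (Re (Vt x) - alpha x ^ 2 + betat x ^ 2)) cd HI) as (a & da & ea).
{ intros x Hx. apply is_derive_on_minus.
  - exact (riccati_Re I V _ x Hx hy).
  - exact (riccati_Re I Vt _ x Hx hyt). }
{ intros x. solve_continuous. }
pose (dUh := fun x => Re (V' (clamp c d x)) - Re (Vt' (clamp c d x))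
   - 2 * betat (clamp c d x) *
     (Im (Vt (clamp c d x)) - 2 * alpha (clamp c d x) * betat (clamp c d x))).
assert (fr : riccati_frame u0 u1 al vh a b U dUh sg P E).
{ constructor.
  - intros x _. apply ca.
  - intros x _. apply cV2.
  - intros x _. unfold dUh. solve_continuous.
  - intros x _. apply dU.
  - intros x Hx. evar_last; [apply da|]. unfold al.
    rewrite clamp_id, eU, ea, eb by lra.
    rewrite (Ufun_eq I V Vt alpha betat x hI (HI x ltac:(lra)) hyt). ring.
  - intros x Hx. evar_last; [apply db|]. unfold al, vh.
    rewrite clamp_id, ea, eb by lra. ring.
  - intros x _. apply dsg.
  - intros x _. apply dP.
  - intros x Hx. evar_last; [apply dE|]. unfold al.
    rewrite clamp_id, ea by lra. ring.
  - intros x. apply exp_pos.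
  - intros x. apply exp_pos.
  - intros x Hx. rewrite eb by lra. apply hyim, HI. lra. }
assert (esg : forall x, c <= x <= d -> Defs.sigma base alpha x = sg x).
{ intros x Hx. unfold Defs.sigma, sg.
  rewrite (RInt_clamp (fun t => 2 * alpha t) c d base x); [reflexivity|lra|exact Hx]. }
assert (ekappa : forall x, c <= x <= d -> sg x * kappa base V Vt alpha g x = g x + W x).
{ intros x Hx. unfold kappa. rewrite esg by exact Hx.
  replace (RInt _ base x) with (W x).
  - field. apply Rgt_not_eq, exp_pos.
  - unfold W, vh. symmetry.
    apply (RInt_ext (V := R_CompleteNormedModule)). intros t Ht.
    assert (Ht' : c <= t <= d).
    { revert Ht. unfold Rmin, Rmax. destruct Rle_dec; lra. }
    rewrite esg, clamp_id by exact Ht'. reflexivity. }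
assert (Hconst : forall x z, c <= x <= d -> c <= z <= d ->
   W x + sg x * bt x - P x = W z + sg z * bt z - P z).
{ assert (dM : forall x, c <= x <= d -> is_derive (fun t => W t + sg t * bt t - P t) x 0).
  { intros x Hx. evar_last.
    - apply (is_derive_minus (fun t => W t + sg t * bt t) P); [|apply dP].
      apply (is_derive_plus W (fun t => sg t * bt t)); [apply dW|].
      apply (is_derive_mult sg bt); [apply dsg|apply dbt|intros; apply Rmult_comm].
    - unfold al, vh, minus, plus, opp, mult; simpl.
      rewrite clamp_id, ebt by lra. ring. }
  intros x z Hx Hz. apply (constant_on_segment (fun t => W t + sg t * bt t - P t) c d); auto.
  - intros t Ht. apply dM; lra.
  - intros t Ht. eapply is_derive_continuous, dM, Ht. }
assert (HsgS : forall x, c <= x <= d -> sg x * S x - P x = g x + (W c + sg c * bt c - P c)).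
{ intros x Hx. rewrite (Hconst c x) by lra.
  rewrite hS, Rmult_plus_distr_l, ekappa, ebt by auto. ring. }
rewrite <- (ea u1), <- (eb u1), <- (eU u1) by lra.
apply (disc_propagates u0 u1 al vh a b U dUh sg P E S); auto.
- intros x z Hx Hxz Hz. rewrite !HsgS by lra.
  apply Rplus_le_compat_r, hg; [apply HI; lra|apply HI; lra|exact Hxz].
- intros x Hx. apply hSpos, HI. lra.
- intros x Hx. rewrite eU by lra. apply hR, HI. lra.
- intros x Hx. assert (Ix : I x) by (apply HI; lra).
  specialize (hD x Ix). unfold determinator in hD.
  rewrite (Derive_on_eq I (Ufun I V alpha) x _ hI Ix
    (Ufun_derive I V _ Vt _ alpha betat x hI Ix hyt (HV' x Ix) (HVt' x Ix))) in hD.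
  unfold determinator_at, al, vh, dUh. rewrite clamp_id, eU by lra. exact hD.
- rewrite ea, eb, eU by lra. exact hstart.
Qed.

Theorem proposition3p5
  (I : R -> Prop) (hI : is_interval I)
  (base : R) (hbase : I base)
  (V Vt : R -> C)
  (hV : C1_on (E := C_R_NormedModule) I V)
  (hVt : C1_on (E := C_R_NormedModule) I Vt)
  (alpha betat : R -> R)
  (hyt : riccati_solution I Vt (fun u => (alpha u, betat u) : C))
  (g : R -> R)
  (hg : forall u v : R, I u -> I v -> u <= v -> g u <= g v)
  (rad beta : R -> R)
  (hsum : forall u : R, I u ->
    rad u + beta u = betat u + kappa base V Vt alpha g u)
  (hdiff : forall u : R, I u ->
    rad u - beta u = Ufun I V alpha u / (rad u + beta u))
  (hsum_neq0 : forall u : R, I u -> rad u + beta u <> 0)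
  (hrad : forall u : R, I u -> 0 <= rad u)
  (hsumD : forall u : R, I u ->
    0 <= (rad u + beta u) * determinator I V alpha beta u)
  (hD : forall u : R, I u -> 0 < determinator I V alpha beta u) :
  (forall y : R -> C,
     riccati_solution I V y ->
     (forall u : R, I u -> 0 < Im (y u)) ->
     forall u0 u1 : R, I u0 -> I u1 -> u0 < u1 ->
       Cmod (y u0 - (alpha u0, beta u0))%C <= rad u0 ->
       Cmod (y u1 - (alpha u1, beta u1))%C <= rad u1)
  /\
  (forall u : R, I u ->
     kappa base V Vt alpha g u - rad u
     = (kappa base V Vt alpha g u ^ 2 - Re (V u - Vt u)%C)
       / (2 * (betat u + kappa base V Vt alpha g u))).
Proof.
split.
- intros y hy hyim u0 u1 hu0 hu1 h01.
  pose (S := fun u => rad u + beta u).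
  assert (eR : forall u, I u -> circle_radius (Ufun I V alpha u) (S u) = rad u).
  { intros u Hu. unfold circle_radius, S. rewrite <- hdiff by exact Hu. field. }
  assert (eh : forall u, I u -> circle_height (Ufun I V alpha u) (S u) = beta u).
  { intros u Hu. unfold circle_height, S. rewrite <- hdiff by exact Hu. field. }
  assert (eU : forall u, I u -> Ufun I V alpha u = rad u ^ 2 - beta u ^ 2).
  { intros u Hu.
    replace (rad u ^ 2 - beta u ^ 2) with ((rad u - beta u) * (rad u + beta u)) by ring.
    rewrite hdiff by exact Hu. field. apply hsum_neq0, Hu. }
  assert (epow : forall u, I u ->
    circle_power (Re (y u) - alpha u) (Im (y u)) (Ufun I V alpha u) (S u) <= 0 <->
    Cmod (y u - (alpha u, beta u))%C <= rad u).
  { intros u Hu. rewrite disc_iff_power by (apply hrad, Hu).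
    unfold circle_power. rewrite eh, eU by exact Hu. reflexivity. }
  rewrite <- !epow by assumption.
  apply (disc_invariant I hI base hbase V Vt hV hVt alpha betat g S y); auto.
  + intros u Hu. pose proof (hsum_neq0 u Hu). pose proof (hsumD u Hu). pose proof (hD u Hu).
    unfold S. destruct (Rtotal_order (rad u + beta u) 0) as [|[|]]; [nra|lra|lra].
  + intros u Hu. rewrite eR by exact Hu. apply hrad, Hu.
  + intros u Hu. unfold determinator. rewrite eh by exact Hu. apply hD, Hu.
- intros u Hu.
  pose proof (hsum u Hu) as Hs. pose proof (hdiff u Hu) as Hd.
  pose proof (hsum_neq0 u Hu) as H0.
  rewrite (Ufun_eq I V Vt alpha betat u hI Hu hyt) in Hd.
  rewrite Hs in Hd, H0.
  set (k := kappa base V Vt alpha g u) in *.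
  assert (Hr : rad u = (betat u + k +
    (Re (V u) - Re (Vt u) - betat u ^ 2) / (betat u + k)) / 2) by lra.
  rewrite Hr. replace (Re (V u - Vt u)%C) with (Re (V u) - Re (Vt u)) by reflexivity.
  field. exact H0.
Qed.
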